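(* Let $n\ge1$ and $m=2n-1$. Every vertex of the bidirectional ballot polytope $\mathcal{P}_n$ is a vertex of the unit cube $[0,1]^m$, i.e. every vertex of $\mathcal{P}_n$ lies in $\{0,1\}^m$.
   Context: The left ballot vectors are $L_n=\{w_1,\dots,w_{n-1}\}\subset\mathbb{R}^m$, where $w_k$ consists of $k$ copies of the pair $(1,-1)$ followed by $m-2k$ zeros; the right ballot vectors are $R_n=\{u_1,\dots,u_{n-1}\}$, where $u_k$ consists of $m-2k$ zeros followed by $k$ copies of the pair $(-1,1)$; $V_n=L_n\cup R_n$. The bidirectional ballot polytope is $\mathcal{P}_n=\{x\in[0,1]^m: x\cdot w\ge0\ \forall w\in V_n\}$. *)

(* Defs.v *)
From mathcomp Require Export all_boot all_order all_algebra.
From mathcomp Require Export boolp classical_sets reals.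

Set Implicit Arguments.
Unset Strict Implicit.
Unset Printing Implicit Defensive.

Import Order.TTheory GRing.Theory Num.Theory.

Local Open Scope ring_scope.
Local Open Scope classical_set_scope.

Section Ballot.
Variable R : realType.

Definition dotv (m : nat) (x y : 'rV[R]_m) : R := \sum_(i < m) x 0 i * y 0 i.

Definition unit_cube (m : nat) : set 'rV[R]_m :=
  [set x | forall i : 'I_m, 0 <= x 0 i <= 1].

(* Vertices are extreme points. *)
Definition vertex (m : nat) (P : set 'rV[R]_m) (x : 'rV[R]_m) : Prop :=
  P x /\ forall (y z : 'rV[R]_m) (t : R), P y -> P z -> 0 < t < 1 ->
    x = t *: y + (1 - t) *: z -> y = x /\ z = x.

(* The lists below have length m as soon as 2k <= m; in left_ballot and
   right_ballot, k <= n - 1, so that 2k <= 2n - 2 < m. *)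
Definition left_vec (m k : nat) : 'rV[R]_m :=
  \row_(i < m)
    nth 0 (flatten (nseq k [:: 1; -1]) ++ nseq (m - 2 * k) 0) i.

Definition right_vec (m k : nat) : 'rV[R]_m :=
  \row_(i < m)
    nth 0 (nseq (m - 2 * k) 0 ++ flatten (nseq k [:: -1; 1])) i.

Definition left_ballot (n : nat) : set 'rV[R]_(2 * n - 1) :=
  [set left_vec (2 * n - 1) k | k in [set k : nat | (1 <= k <= n - 1)%N]].

Definition right_ballot (n : nat) : set 'rV[R]_(2 * n - 1) :=
  [set right_vec (2 * n - 1) k | k in [set k : nat | (1 <= k <= n - 1)%N]].

Definition ballot_vectors (n : nat) : set 'rV[R]_(2 * n - 1) :=
  @left_ballot n `|` @right_ballot n.

Definition ballot_polytope (n : nat) : set 'rV[R]_(2 * n - 1) :=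
  [set x | unit_cube x /\ forall w, @ballot_vectors n w -> 0 <= dotv x w].

End Ballot.

Arguments unit_cube R m : clear implicits.
Arguments ballot_vectors R n : clear implicits.
Arguments ballot_polytope R n : clear implicits.

(* Main.v *)
Require Import Defs.
From mathcomp Require Import zify ring lra.

(** The signed prefix sums p_j = x_0 - x_1 + x_2 - ... (j terms) turn every
    inequality defining the polytope into a difference constraint
    p_a - p_b + c >= 0 with c in {0, 1}: the cube bounds compare consecutive
    prefix sums, the left ballot vectors compare p_2k with p_0, and, m being
    odd, the right ones compare p_m with p_(m-2k).  If some p_j is not an
    integer, shift by a small e the prefix sums that are congruent to p_j
    modulo 1.  A tight constraint relates congruent prefix sums and stays
    tight, the others have slack, and p_0 = 0 does not move; so x + e d and
    x - e d both lie in the polytope and x is not a vertex.  Hence all p_j, and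
    with them all the coordinates of x, are integers. *)

Set Implicit Arguments.
Unset Strict Implicit.
Unset Printing Implicit Defensive.

Import Order.TTheory GRing.Theory Num.Theory.

Local Open Scope ring_scope.

Lemma finite_positive_lower_bound (R : realDomainType) (I : finType)
    (f : I -> R) :
  exists2 e, 0 < e & forall i, 0 < f i -> e <= f i.
Proof.
(* The cap 1 keeps the minimum positive even when no value of [f] is. *)
exists (\big[Num.min/1]_(i | 0 < f i) f i).
  by elim/big_ind: _ => // a b a0 b0; rewrite lt_min a0.
by move=> i fi; rewrite (bigD1 i) //= ge_min lexx.
Qed.

Section BallotVertices.
Variable R : realType.

Lemma nth_flatten_nseq_pair (a b : R) k i : (i < 2 * k)%N ->
  nth 0 (flatten (nseq k [:: a; b])) i = if odd i then b else a.
Proof.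
elim: k i => [|k IHk] [|[|i]] //= ik.
by rewrite IHk ?negbK //; lia.
Qed.

Lemma size_flatten_nseq_pair (a b : R) k :
  size (flatten (nseq k [:: a; b])) = (2 * k)%N.
Proof. by elim: k => //= k ->; lia. Qed.

Lemma left_vecE m k (i : 'I_m) :
  left_vec R m k 0 i = if (i < 2 * k)%N then (-1) ^+ i else 0.
Proof.
rewrite mxE nth_cat size_flatten_nseq_pair; case: ltnP => ik.
  by rewrite nth_flatten_nseq_pair // -signr_odd; case: odd.
by rewrite nth_nseq if_same.
Qed.

(** For odd [m] the nonzero block starts at the odd index [m - 2 * k], so its leading -1 agrees with
    the sign [(-1) ^+ i]. *)
Lemma right_vecE m k (i : 'I_m) : odd m -> (2 * k <= m)%N ->
  right_vec R m k 0 i = if (i < m - 2 * k)%N then 0 else (-1) ^+ i.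
Proof.
move=> om km; rewrite mxE nth_cat size_nseq; case: ltnP => ik.
  by rewrite nth_nseq if_same.
have im := ltn_ord i.
rewrite nth_flatten_nseq_pair; last by lia.
rewrite -signr_odd oddB // oddB // om mul2n odd_double /=.
by case: odd.
Qed.

Definition prefix_sum m (x : 'rV[R]_m) j : R :=
  \sum_(i < m | (i < j)%N) (-1) ^+ i * x 0 i.

(** Inverse of [prefix_sum] on sequences with [q 0 = 0]; it carries perturbed prefix sums back to
    vectors. *)
Definition signed_increments m (q : nat -> R) : 'rV[R]_m :=
  \row_(i < m) ((-1) ^+ i * (q i.+1 - q i)).

Lemma prefix_sum0 m (x : 'rV[R]_m) : prefix_sum x 0 = 0.
Proof. by rewrite /prefix_sum big1. Qed.

Lemma prefix_sumS m (x : 'rV[R]_m) (i : 'I_m) :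
  prefix_sum x i.+1 = prefix_sum x i + (-1) ^+ i * x 0 i.
Proof.
rewrite /prefix_sum (bigD1 i) //= addrC; congr (_ + _).
apply: eq_bigl => j; rewrite ltnS ltn_neqAle andbC.
by congr (_ && _).
Qed.

Lemma prefix_sumK m (x : 'rV[R]_m) (i : 'I_m) :
  x 0 i = (-1) ^+ i * (prefix_sum x i.+1 - prefix_sum x i).
Proof.
by rewrite prefix_sumS addrAC subrr add0r mulrA -expr2 sqrr_sign mul1r.
Qed.

Lemma prefix_sum_signed_increments m (q : nat -> R) j : q 0%N = 0 ->
  (j <= m)%N -> prefix_sum (signed_increments m q) j = q j.
Proof.
move=> q0; elim: j => [|j IHj] jm; first by rewrite prefix_sum0.
rewrite (prefix_sumS _ (Ordinal jm)) /= IHj; last exact: ltnW.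
by rewrite mxE /= mulrA -expr2 sqrr_sign mul1r addrC subrK.
Qed.

Lemma dotv_left_vec m (x : 'rV[R]_m) k :
  dotv x (left_vec R m k) = prefix_sum x (2 * k).
Proof.
rewrite /dotv /prefix_sum [RHS]big_mkcond; apply: eq_bigr => i _.
by rewrite left_vecE; case: ifP => _; rewrite ?mulr0 // mulrC.
Qed.

Lemma dotv_right_vec m (x : 'rV[R]_m) k : odd m -> (2 * k <= m)%N ->
  dotv x (right_vec R m k) = prefix_sum x m - prefix_sum x (m - 2 * k).
Proof.
move=> om km; apply/eqP; rewrite eq_sym subr_eq /dotv /prefix_sum.
rewrite [in X in _ == X + _]big_mkcond [in X in _ == _ + X]big_mkcond /=.
rewrite -big_split /= [X in X == _]big_mkcond /=.
apply/eqP/eq_bigr => i _; rewrite right_vecE // ltn_ord.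
by case: ifP => _; rewrite ?mulr0 ?add0r ?addr0 // mulrC.
Qed.

(* The polytope is cut out by difference constraints on the prefix sums, so
   preserving all of those that hold at [x] preserves membership. *)
Lemma ballot_polytope_signed_increments n (x : 'rV[R]_(2 * n - 1))
    (q : nat -> R) : (1 <= n)%N -> q 0%N = 0 ->
  (forall (a b : nat) (c : bool), (a <= 2 * n - 1)%N -> (b <= 2 * n - 1)%N ->
     0 <= prefix_sum x a - prefix_sum x b + c%:R -> 0 <= q a - q b + c%:R) ->
  ballot_polytope R n x ->
  ballot_polytope R n (signed_increments (2 * n - 1) q).
Proof.
move=> n1 q0 pq [cx bx].
have om : odd (2 * n - 1) by rewrite oddB ?mul2n ?odd_double //; lia.
split=> [i|w].
  have im := ltn_ord i; have := cx i; rewrite (prefix_sumK x i) mxE.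
  (* The parity of [i] decides which two of these four constraints encode the bounds 0 and 1 on the
     coordinate. *)
  have := pq i.+1 i false im (ltnW im); have := pq i.+1 i true im (ltnW im).
  have := pq i i.+1 false (ltnW im) im; have := pq i i.+1 true (ltnW im) im.
  rewrite -signr_odd; case: odd => /=; rewrite ?expr1 ?expr0 => h1 h2 h3 h4.
    move=> /andP[x0 x1].
    have {}h2 := h2 ltac:(lra); have {}h3 := h3 ltac:(lra).
    by apply/andP; split; lra.
  move=> /andP[x0 x1].
  have {}h1 := h1 ltac:(lra); have {}h4 := h4 ltac:(lra).
  by apply/andP; split; lra.
case=> -[k /= /andP[k1 kn] <-].
- have := bx (left_vec R _ k) (or_introl (ex_intro2 _ _ k _ erefl)).
  rewrite !dotv_left_vec /= k1 kn => /(_ isT) h.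
  rewrite prefix_sum_signed_increments //; last by lia.
  have := pq (2 * k)%N 0%N false ltac:(lia) isT.
  by rewrite prefix_sum0 q0 !subr0 !addr0; apply.
- have := bx (right_vec R _ k) (or_intror (ex_intro2 _ _ k _ erefl)).
  rewrite !dotv_right_vec //=; [|lia..].
  rewrite k1 kn => /(_ isT) h.
  rewrite !prefix_sum_signed_increments //; last by lia.
  have := pq (2 * n - 1)%N (2 * n - 1 - 2 * k)%N false ltac:(lia) ltac:(lia).
  by rewrite !addr0; apply.
Qed.

(** Take for [e] a lower bound of all positive slacks: the shift changes a difference by at most
    [|s|]. At zero slack [p a - p b] is an integer, so both terms shift or neither does. *)
Lemma small_integral_class_shift N (p : nat -> R) (r : R) :
  exists2 e, 0 < e & forall s : R, `|s| <= e ->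
    forall (a b : nat) (c : bool), (a <= N)%N -> (b <= N)%N ->
      0 <= p a - p b + c%:R ->
      0 <= (p a + s * (p a - r \is a Num.int)%:R)
           - (p b + s * (p b - r \is a Num.int)%:R) + c%:R.
Proof.
pose slack (t : 'I_N.+1 * 'I_N.+1 * bool) : R :=
  p t.1.1 - p t.1.2 + (t.2 : bool)%:R.
have [e e0 he] := finite_positive_lower_bound slack.
exists e => // s; rewrite ler_norml => /andP[s1 s2] a b c aN bN.
rewrite le_eqVlt => /orP[/eqP tight|pos].
  suff -> : (p a - r \is a Num.int) = (p b - r \is a Num.int) by lra.
  have -> : p a - r = p b - r - c%:R by lra.
  by rewrite rpredBr // natr_int.
have := he (Ordinal (aN : (a < N.+1)%N), Ordinal (bN : (b < N.+1)%N), c) pos.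
rewrite /slack /=.
by case: (_ \is a _); case: (_ \is a _) => /=; lra.
Qed.

Lemma ballot_vertex_prefix_sum_int n (x : 'rV[R]_(2 * n - 1)) j :
  (1 <= n)%N -> vertex (ballot_polytope R n) x -> (j <= 2 * n - 1)%N ->
  prefix_sum x j \is a Num.int.
Proof.
move=> n1 [Px xtr] jm; apply: contraT => pj.
set r := prefix_sum x j in pj.
have [e e0 he] := small_integral_class_shift (2 * n - 1) (prefix_sum x) r.
pose q s a := prefix_sum x a + s * (prefix_sum x a - r \is a Num.int)%:R.
(* As [r] is not an integer, the zeroth prefix sum is not in its class. *)
have q0 s : q s 0%N = 0.
  by rewrite /q prefix_sum0 sub0r rpredN (negPf pj) mulr0 addr0.
have Pq s : `|s| <= e ->
    ballot_polytope R n (signed_increments (2 * n - 1) (q s)).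
  by move=> se; apply: ballot_polytope_signed_increments Px => //; apply: he.
(* [x] is the midpoint of the shifts by [e] and [- e]. *)
have [||||yx _] := xtr (signed_increments _ (q e))
                       (signed_increments _ (q (- e))) (1 / 2).
- by apply: Pq; rewrite gtr0_norm.
- by apply: Pq; rewrite normrN gtr0_norm.
- by apply/andP; split; lra.
- by apply/rowP => i; rewrite !mxE (prefix_sumK x i) /q; field.
(* Comparing the prefix sums at [j] gives [r + e = r], against [0 < e]. *)
have := prefix_sum_signed_increments (q0 e) jm.
rewrite yx /q -/r subrr int_num0 mulr1 => /eqP.
by rewrite eq_sym addrC -subr_eq0 addrK gt_eqF.
Qed.

(** Coordinatewise, 0 and 1 are extreme in the interval from 0 to 1. *)
Lemma unit_cube_vertex01 m (x : 'rV[R]_m) :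
  (forall i, x 0 i = 0 \/ x 0 i = 1) -> vertex (unit_cube R m) x.
Proof.
move=> x01; split=> [i|y z t cy cz /andP[t0 t1] xE].
  by case: (x01 i) => ->; rewrite lexx ler01.
suff yzx i : y 0 i = x 0 i /\ z 0 i = x 0 i.
  by split; apply/rowP => i; case: (yzx i).
have /andP[y0 y1] := cy i; have /andP[z0 z1] := cz i.
have := congr1 (fun u : 'rV[R]_m => u 0 i) xE; rewrite !mxE.
by case: (x01 i) => -> h; split; nra.
Qed.

End BallotVertices.

Theorem theorem3p4 (R : realType) (n : nat) (hn : (1 <= n)%N)
    (x : 'rV[R]_(2 * n - 1)) (hx : vertex (ballot_polytope R n) x) :
  vertex (unit_cube R (2 * n - 1)) x /\
  forall i : 'I_(2 * n - 1), x 0 i = 0 \/ x 0 i = 1.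
Proof.
suff x01 i : x 0 i = 0 \/ x 0 i = 1 by split=> //; apply: unit_cube_vertex01.
have im := ltn_ord i.
have xint : x 0 i \is a Num.int.
  rewrite prefix_sumK rpredMsign rpredB //.
    exact: ballot_vertex_prefix_sum_int.
  exact: ballot_vertex_prefix_sum_int (ltnW im).
have [cx _] := hx.1; move: (cx i).
have /intrP[z ->] := xint; rewrite ler0z lerz1 => /andP[z0 z1].
have [->|->] : z = 0 \/ z = 1 by lia.
- by left.
- by right.
Qed.
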